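(* Let $\gamma,n$ be odd positive integers and $N$ a positive integer, and suppose that $n$ starts an integral loop of length $N$ (for the map $C_\gamma$). Let $\rho$ and $\nu$ be the numbers of zeros and ones in a single period of the characteristic trajectory of $n$, let $[n]$ be the integral loop vector of $n$, and let $\mathcal{M}_n$ be the $\nu\times\nu$ matrix associated to $n$. Then $$[n]=\frac{\gamma}{2^\rho-3^\nu}\,\mathcal{M}_n\,\overrightarrow{\mathfrak{3}}^{\nu}.$$
   Context: For an odd positive integer $\gamma$, $C_\gamma:\mathbb{Z}_{>0}\to\mathbb{Z}_{>0}$ is $C_\gamma(x)=3x+\gamma$ if $x$ is odd, $C_\gamma(x)=x/2$ if $x$ is even; $C_\gamma^k$ is the $k$-fold iterate ($C_\gamma^0=\mathrm{id}$). $n$ starts an integral loop of length $N$ if $N$ is the least positive integer with $C_\gamma^N(n)=n$. $\chi_\gamma^i(n)\in\{0,1\}$ is the parity of $C_\gamma^i(n)$ ($1$ if odd, $0$ if even); the characteristic trajectory is $B=(\chi_\gamma^i(n))_{i\ge0}$, and a single period consists of the indices $0\le i\le N-1$. For $n$ odd, let $0=i_0<i_1<\cdots<i_{\nu-1}\le N-1$ be the indices in $[0,N-1]$ with $\chi_\gamma^{i_j}(n)=1$. For $1\le j\le\nu-1$, $m_j$ is the number of zeros of $B$ strictly between positions $i_{j-1}$ and $i_j$, and $m_\nu$ is the number of zeros at positions after $i_{\nu-1}$ and at most $N-1$. The integral loop vector is the column vector $[n]=(C_\gamma^{i_0}(n),C_\gamma^{i_1}(n),\ldots,C_\gamma^{i_{\nu-1}}(n))^T$.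 The vector $\overrightarrow{\mathfrak{3}}^{\nu}$ is the column vector $(3^{\nu-1},3^{\nu-2},\ldots,3,1)^T$. Let $|j|_\nu\in\{0,\ldots,\nu-1\}$ be $j$ modulo $\nu$ and $e_{j,k}$ the $\nu\times\nu$ matrix units. Then $\mathcal{D}_n=\sum_{j=1}^\nu 2^{m_j}e_{j,|j|_\nu+1}$ and $\mathcal{M}_n=\sum_{k=1}^{\nu}\mathcal{D}_n^{k-1}\sum_{j=1}^\nu e_{j,k}$ (with $\mathcal{D}_n^0$ the identity). *)

(* Defs.v *)
(* The map is stated on nat, where the positive integers are stable for gamma
   odd; an odd number is positive. *)
From mathcomp Require Import all_boot all_order all_algebra.

Set Implicit Arguments.
Unset Strict Implicit.
Unset Printing Implicit Defensive.

Import GRing.Theory.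

Local Open Scope nat_scope.

Definition collatz (gamma x : nat) : nat :=
  if odd x then 3 * x + gamma else x./2.

Definition starts_loop (gamma n N : nat) : Prop :=
  [/\ 0 < N, iter N (collatz gamma) n = n
    & forall k, 0 < k < N -> iter k (collatz gamma) n <> n].

Definition chi (gamma n i : nat) : nat := odd (iter i (collatz gamma) n).

Definition chi_period (gamma n N : nat) : seq nat :=
  [seq chi gamma n i | i <- iota 0 N].

Definition nzeros (gamma n N : nat) : nat := count_mem 0 (chi_period gamma n N).

Definition nones (gamma n N : nat) : nat := count_mem 1 (chi_period gamma n N).

(* The increasing sequence i_0 < i_1 < ... < i_(nu - 1) of positions of ones. *)
Definition one_positions (gamma n N : nat) : seq nat :=
  [seq i <- iota 0 N | chi gamma n i == 1].

Definition one_pos (gamma n N j : nat) : nat := nth 0 (one_positions gamma n N) j.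

(* m_j, meaningful for 1 <= j <= nu. *)
Definition gap (gamma n N j : nat) : nat :=
  if j < nones gamma n N then
    \sum_(0 <= i < N | one_pos gamma n N j.-1 < i < one_pos gamma n N j)
      (chi gamma n i == 0)
  else
    \sum_(0 <= i < N | one_pos gamma n N j.-1 < i) (chi gamma n i == 0).

Local Open Scope ring_scope.

Definition loop_vector (gamma n N : nat) : 'cV[rat]_(nones gamma n N) :=
  \col_(j < nones gamma n N) (iter (one_pos gamma n N j) (collatz gamma) n)%:R.

Definition vec3 (nu : nat) : 'cV[rat]_nu := \col_(j < nu) 3 ^+ (nu.-1 - j).

(* Rows and columns are numbered from 0, so the 1-based row j and column
   (j mod nu) + 1 become j and ordS j = (j + 1) mod nu, with exponent
   m_(j + 1). *)
Definition loopD (gamma n N : nat) : 'M[rat]_(nones gamma n N) :=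
  \sum_(j < nones gamma n N) 2 ^+ gap gamma n N j.+1 *: delta_mx j (ordS j).

(* ^+ is the power for the matrix product *m; D ^+ 0 is the identity. *)
Definition loopM (gamma n N : nat) : 'M[rat]_(nones gamma n N) :=
  \sum_(k < nones gamma n N)
    (loopD gamma n N ^+ k *m \sum_(j < nones gamma n N) delta_mx j k).

(* Main.v *)
Require Import Defs.
From mathcomp Require Import all_boot all_order all_algebra.
From mathcomp Require Import zify.

Set Implicit Arguments.
Unset Strict Implicit.
Unset Printing Implicit Defensive.

(** Write x for the loop vector, D for the weighted cyclic shift [loopD] and 1
    for the all-ones column.  Going from one odd term of the loop to the next
    applies 3x + gamma once and then halves once per zero in between, so
    2 ^ m_(j+1) times the next odd term is 3 times the current one plus gamma;
    because the loop closes up, this also holds from the last odd term back to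
    the first ([loopD_loop_vector]).  All these relations together are the
    affine equation D x = 3 x + gamma 1.

    Such an equation is solved by the geometric sum
    (D^nu - 3^nu) x = sum_k 3^(nu-1-k) D^k (D - 3) x
                    = gamma sum_k 3^(nu-1-k) D^k 1 ([affine_eigen_geometric]),
    whose last sum is M_n applied to the vector of powers of 3
    ([loopM_vec3]).  Going once around the cycle multiplies by all the weights,
    so D^nu is the scalar 2^(m_1 + ... + m_nu) ([cyclic_shift_full_turn]), and
    the gaps m_j add up to the number of zeros in a period ([sum_gap]).
    Finally 2^rho - 3^nu is nonzero since nu > 0: by parity if rho > 0, and
    because 3^nu > 1 if rho = 0. *)

Import GRing.Theory Num.Theory.

Local Open Scope ring_scope.

(** * Affine equations and weighted cyclic shifts *)

(** The summand at k is t (k+1) - t k for t k = c^(p-k) A^k x, so the sum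
    telescopes. *)
Lemma affine_eigen_geometric (R : comPzRingType) (nu p : nat)
    (A : 'M[R]_nu) (c : R) (x b : 'cV[R]_nu) :
  A *m x = c *: x + b ->
  \sum_(k < p) c ^+ (p.-1 - k) *: (A ^+ k *m b) = A ^+ p *m x - c ^+ p *: x.
Proof.
move=> Ax; have -> : b = A *m x - c *: x by rewrite Ax addrC addKr.
pose t k : 'cV[R]_nu := c ^+ (p - k) *: (A ^+ k *m x).
transitivity (\sum_(0 <= k < p) (t k.+1 - t k)).
  rewrite big_mkord; apply: eq_bigr => k _.
  have -> : (p.-1 - k = p - k.+1)%N by lia.
  have -> : t k = c ^+ (p - k.+1) *: (c *: (A ^+ k *m x)).
    by rewrite scalerA -exprSr subnSK.
  by rewrite mulmxBr mulmxA -scalemxAr scalerBr /t exprSr.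
by rewrite telescope_sumr // /t subnn expr0 scale1r subn0 expr0 mul1mx.
Qed.

Lemma val_iter_ordS (nu k : nat) (j : 'I_nu) :
  (iter k (@ordS nu) j = (j + k) %% nu :> nat)%N.
Proof.
elim: k => [|k IHk]; first by rewrite addn0 modn_small.
by rewrite iterS /= IHk -addn1 modnDml addn1 addnS.
Qed.

Definition cyclic_shift (R : pzRingType) (nu : nat) (w : 'I_nu -> R) :
  'M[R]_nu := \sum_j w j *: delta_mx j (ordS j).

Lemma cyclic_shift_mul (R : pzRingType) (nu : nat) (w : 'I_nu -> R)
    (x : 'cV[R]_nu) (j : 'I_nu) :
  (cyclic_shift w *m x) j 0 = w j * x (ordS j) 0.
Proof.
rewrite mxE (bigD1 (ordS j)) //= big1 ?addr0 => [|i ne_i].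
  rewrite summxE (bigD1 j) //= big1 ?addr0 => [|i ne_i].
    by rewrite !mxE !eqxx mulr1.
  by rewrite !mxE eq_sym (negbTE ne_i) mulr0.
rewrite summxE big1 ?mul0r // => k _; rewrite !mxE.
have [Dj|_] := eqVneq j k; last by rewrite mulr0.
by rewrite -Dj (negbTE ne_i) mulr0.
Qed.

Lemma cyclic_shift_expr_mul (R : comPzRingType) (nu : nat) (w : 'I_nu -> R)
    (k : nat) (x : 'cV[R]_nu) (j : 'I_nu) :
  (cyclic_shift w ^+ k *m x) j 0
    = (\prod_(i < k) w (iter i (@ordS nu) j)) * x (iter k (@ordS nu) j) 0.
Proof.
elim: k x => [|k IHk] x; first by rewrite big_ord0 mul1r expr0 mul1mx.
rewrite exprSr -mulmxA IHk cyclic_shift_mul big_ord_recr /=.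
by rewrite mulrA.
Qed.

(** Starting from any index, [nu] successive steps meet each index once and
    come back. *)
Lemma cyclic_shift_full_turn (R : comPzRingType) (nu : nat) (w : 'I_nu -> R)
    (x : 'cV[R]_nu) :
  cyclic_shift w ^+ nu *m x = (\prod_j w j) *: x.
Proof.
apply/colP => j; rewrite cyclic_shift_expr_mul mxE.
have -> : iter nu (@ordS nu) j = j.
  by apply: val_inj; rewrite /= val_iter_ordS modnDr modn_small.
congr (_ * _).
rewrite [RHS](reindex_inj (h := fun i : 'I_nu => iter i (@ordS nu) j)) //.
move=> i1 i2 /(congr1 val) /=; rewrite !val_iter_ordS => /eqP.
rewrite eqn_modDl !modn_small // => /eqP eq_i; exact: val_inj.
Qed.

(** * Positions of the odd terms *)

Lemma nones_size (gamma n N : nat) :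
  nones gamma n N = size (one_positions gamma n N).
Proof. by rewrite /nones count_map size_filter. Qed.

Lemma nzeros_add_nones (gamma n N : nat) :
  (nzeros gamma n N + nones gamma n N = N)%N.
Proof.
rewrite /nzeros /nones !count_map -[RHS](size_iota 0).
rewrite -(count_predC (preim (chi gamma n) (pred1 0%N))).
by congr (_ + _)%N; apply: eq_count => i /=; rewrite /chi; case: odd.
Qed.

(** The positions of ones closed up by the end [N] of the period, so that every
    gap, the last one included, lies between two consecutive values. *)
Definition odd_pos (gamma n N j : nat) : nat :=
  nth N (one_positions gamma n N) j.

Lemma odd_pos_le (gamma n N j : nat) : (odd_pos gamma n N j <= N)%N.
Proof.
rewrite /odd_pos; have [lt_j|ge_j] := ltnP j (size (one_positions gamma n N)).
  have := mem_nth N lt_j; rewrite mem_filter mem_iota.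
  by case/and3P=> _ _ /ltnW.
by rewrite nth_default.
Qed.

Lemma one_pos_odd_pos (gamma n N j : nat) :
  (j < nones gamma n N)%N -> one_pos gamma n N j = odd_pos gamma n N j.
Proof. by rewrite nones_size => lt_j; apply: set_nth_default. Qed.

Lemma odd_pos_nones (gamma n N : nat) :
  odd_pos gamma n N (nones gamma n N) = N.
Proof. by rewrite /odd_pos nones_size nth_default. Qed.

Lemma odd_at_odd_pos (gamma n N j : nat) : (j < nones gamma n N)%N ->
  (odd_pos gamma n N j < N)%N
  /\ odd (iter (odd_pos gamma n N j) (collatz gamma) n).
Proof.
rewrite nones_size => lt_j; have := mem_nth N lt_j.
rewrite mem_filter mem_iota -/(odd_pos _ _ _ _) /chi.
by case: odd => // /and3P[].
Qed.

Lemma one_positions_sorted (gamma n N : nat) :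
  sorted ltn (one_positions gamma n N).
Proof. exact/(sorted_filter ltn_trans)/iota_ltn_sorted. Qed.

Lemma odd_pos_ltS (gamma n N j : nat) : (j < nones gamma n N)%N ->
  (odd_pos gamma n N j < odd_pos gamma n N j.+1)%N.
Proof.
move=> lt_j; have [lt_j1|ge_j1] := ltnP j.+1 (nones gamma n N).
  by apply: (sorted_ltn_nth ltn_trans); rewrite ?inE -?nones_size //;
    exact: one_positions_sorted.
have -> : j.+1 = nones gamma n N by lia.
by rewrite odd_pos_nones; case: (odd_at_odd_pos lt_j).
Qed.

(** An odd term strictly in between would sit in the increasing list of
    positions of ones at an index strictly between [j] and [j.+1]. *)
Lemma even_between_odd_pos (gamma n N j i : nat) :
  (j < nones gamma n N)%N ->
  (odd_pos gamma n N j < i < odd_pos gamma n N j.+1)%N ->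
  ~~ odd (iter i (collatz gamma) n).
Proof.
move=> lt_j /andP[lt_i gt_i]; apply/negP => odd_i.
have lt_iN : (i < N)%N by apply: leq_trans gt_i (odd_pos_le _ _ _ _).
have s_i : i \in one_positions gamma n N.
  by rewrite mem_filter mem_iota /chi odd_i /=; lia.
have lt_k : (index i (one_positions gamma n N) < nones gamma n N)%N.
  by rewrite nones_size index_mem.
have Di : i = odd_pos gamma n N (index i (one_positions gamma n N)).
  by rewrite /odd_pos nth_index.
set k := index _ _ in lt_k Di.
have mono a b : (a <= b)%N -> (b < nones gamma n N)%N ->
    (odd_pos gamma n N a <= odd_pos gamma n N b)%N.
  move=> le_ab lt_b; apply: (sorted_leq_nth leq_trans leqnn);
    rewrite ?inE -?nones_size //; last by lia.
  exact/(sub_sorted ltnW)/one_positions_sorted.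
have [le_kj|lt_jk] := leqP k j.
  by have := mono _ _ le_kj lt_j; rewrite -Di; lia.
by have := mono _ _ lt_jk lt_k; rewrite -Di; lia.
Qed.

Lemma gapE (gamma n N j : nat) : (j < nones gamma n N)%N ->
  gap gamma n N j.+1
    = (odd_pos gamma n N j.+1 - (odd_pos gamma n N j).+1)%N.
Proof.
move=> lt_j.
transitivity (\sum_(0 <= i < N |
    odd_pos gamma n N j < i < odd_pos gamma n N j.+1) 1)%N.
  rewrite /gap; case: ifP => lt_j1 /=.
    rewrite !one_pos_odd_pos //; apply: eq_bigr => i /(even_between_odd_pos lt_j).
    by rewrite /chi => /negbTE->.
  have Dj : odd_pos gamma n N j.+1 = N.
    by rewrite -[RHS](odd_pos_nones gamma n N); congr odd_pos; lia.
  rewrite one_pos_odd_pos // big_nat_cond [RHS]big_nat_cond.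
  apply: eq_big => i; first by rewrite Dj; lia.
  move=> /andP[lt_iN gt_i].
  have /(even_between_odd_pos lt_j) :
    (odd_pos gamma n N j < i < odd_pos gamma n N j.+1)%N by rewrite Dj; lia.
  by rewrite /chi => /negbTE->.
have leN := odd_pos_le gamma n N j.+1.
rewrite -[RHS]muln1 -sum_nat_const_nat.
rewrite [RHS](big_nat_widenl _ 0) // [RHS](big_nat_widen _ _ N) //.
Qed.

Lemma odd_pos0 (gamma n N : nat) : odd n -> (0 < N)%N ->
  odd_pos gamma n N 0 = 0%N.
Proof.
by case: N => // N odd_n _; rewrite /odd_pos /one_positions /= /chi /= odd_n.
Qed.

(** As position 0 carries a one, the intervals between consecutive ones tile
    the whole period, each consisting of a one followed by its gap. *)
Lemma sum_gap (gamma n N : nat) : odd n -> (0 < N)%N ->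
  (\sum_(j < nones gamma n N) gap gamma n N j.+1 = nzeros gamma n N)%N.
Proof.
move=> odd_n N_gt0; apply/(@addIn (nones gamma n N)).
rewrite nzeros_add_nones.
transitivity (\sum_(0 <= j < nones gamma n N) (gap gamma n N j.+1 + 1))%N.
  by rewrite big_split /= big_mkord sum_nat_const_nat subn0 muln1.
have step j : (0 <= j < nones gamma n N)%N ->
    (gap gamma n N j.+1 + 1
      = odd_pos gamma n N j.+1 - odd_pos gamma n N j)%N.
  by move=> lt_j; rewrite gapE //; have := odd_pos_ltS lt_j; lia.
rewrite (eq_big_nat _ _ step) telescope_sumn_in //.
  by rewrite odd_pos_nones odd_pos0 ?subn0.
by move=> j /andP[_ lt_j]; apply/ltnW/odd_pos_ltS.
Qed.

(** * The affine equation of a loop *)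

(** Each of the [d] halvings acts on an even term, hence is exact.  Stopping at
    any point before the next odd term is allowed, for the induction on [d]. *)
Lemma collatz_next_odd (gamma n p d : nat) :
  odd (iter p (collatz gamma) n) ->
  (forall i, p < i < p.+1 + d -> ~~ odd (iter i (collatz gamma) n))%N ->
  (2 ^ d * iter (p.+1 + d) (collatz gamma) n
    = 3 * iter p (collatz gamma) n + gamma)%N.
Proof.
move=> odd_p; elim: d => [|d IHd] even_i.
  by rewrite addn0 mul1n iterS /collatz odd_p.
rewrite -IHd => [|i lt_i]; last by apply: even_i; lia.
have /negbTE ev : ~~ odd (iter (p.+1 + d) (collatz gamma) n).
  by apply: even_i; lia.
rewrite addnS iterS {1}/collatz ev expnSr -mulnA mul2n even_halfK //.
by rewrite ev.
Qed.

(** The successor of the last index wraps around to 0: there the orbit is read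
    at time [N], where it has returned to [n]. *)
Lemma loopD_loop_vector (gamma n N : nat) :
  odd n -> starts_loop gamma n N ->
  loopD gamma n N *m loop_vector gamma n N
    = 3 *: loop_vector gamma n N + const_mx gamma%:R.
Proof.
move=> odd_n [N_gt0 loopN _]; apply/colP => j.
rewrite [LHS]cyclic_shift_mul !mxE !one_pos_odd_pos //.
have lt_j := ltn_ord j; have [_ odd_j] := odd_at_odd_pos lt_j.
have -> : iter (odd_pos gamma n N (ordS j)) (collatz gamma) n
        = iter (odd_pos gamma n N j.+1) (collatz gamma) n.
  have [lt_j1|ge_j1] := ltnP j.+1 (nones gamma n N).
    by rewrite /= modn_small.
  have Dj : j.+1 = nones gamma n N by lia.
  by rewrite /= Dj modnn odd_pos_nones odd_pos0.
have ltS := odd_pos_ltS lt_j.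
have Dq : (odd_pos gamma n N j.+1
           = (odd_pos gamma n N j).+1 + gap gamma n N j.+1)%N.
  by rewrite gapE //; lia.
rewrite {1}Dq -natrX -!natrM -natrD collatz_next_odd //.
by move=> i; rewrite -Dq; apply: even_between_odd_pos.
Qed.

Lemma loopM_vec3 (gamma n N : nat) :
  loopM gamma n N *m vec3 (nones gamma n N)
    = \sum_(k < nones gamma n N)
        3 ^+ ((nones gamma n N).-1 - k)
          *: (loopD gamma n N ^+ k *m const_mx 1).
Proof.
rewrite mulmx_suml; apply: eq_bigr => k _.
have entry i l : (\sum_j delta_mx j k : 'M[rat]_(nones gamma n N)) i l
    = (l == k)%:R.
  rewrite summxE (bigD1 i) //= mxE eqxx big1 ?addr0 // => j ne_j.
  by rewrite mxE eq_sym (negbTE ne_j).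
rewrite -mulmxA scalemxAr; congr (_ *m _); apply/colP => i.
rewrite mxE (bigD1 k) //= entry eqxx !mxE mul1r mulr1 big1 ?addr0 //.
by move=> l ne_l; rewrite entry (negbTE ne_l) mul0r.
Qed.

Lemma two_pow_sub_three_pow_neq0 (rho nu : nat) : (0 < nu)%N ->
  2 ^+ rho - 3 ^+ nu != 0 :> rat.
Proof.
move=> nu_gt0; rewrite subr_eq0 -!natrX eqr_nat; apply/eqP => eq23.
have := congr1 odd eq23; rewrite !oddX /= orbT orbF => /eqP rho0.
by have := ltn_exp2l 0 nu (isT : 1 < 3)%N; rewrite nu_gt0 -eq23 rho0.
Qed.

Theorem proposition1p5p2 (gamma n N : nat)
    (gamma_odd : odd gamma) (n_odd : odd n)
    (loop : starts_loop gamma n N) :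
  loop_vector gamma n N =
    (gamma%:R / (2 ^+ nzeros gamma n N - 3 ^+ nones gamma n N)) *:
      (loopM gamma n N *m vec3 (nones gamma n N)).
Proof.
have [N_gt0 _ _] := loop.
have nu_gt0 : (0 < nones gamma n N)%N.
  rewrite lt0n; apply/eqP => nu0; have := odd_pos_nones gamma n N.
  by rewrite nu0 odd_pos0 //; lia.
have turn (x : 'cV_(nones gamma n N)) : loopD gamma n N ^+ nones gamma n N *m x
    = 2 ^+ nzeros gamma n N *: x.
  rewrite -(sum_gap gamma n_odd N_gt0) -prodrXr.
  exact: (cyclic_shift_full_turn (fun j => 2 ^+ gap gamma n N j.+1)).
have := affine_eigen_geometric (nones gamma n N)
  (loopD_loop_vector n_odd loop).
rewrite turn -scalerBl => geo.
rewrite mulrC -scalerA loopM_vec3 scaler_sumr.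
under eq_bigr do rewrite scalerA mulrC -scalerA scalemxAr scalemx_const mulr1.
by rewrite geo scalerA mulVf ?scale1r // two_pow_sub_three_pow_neq0.
Qed.
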